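(* Let $F=\langle W,R,I\rangle$ be an (8-4)-frame. Then $F$ is Euclidean if, and only if, $F\vDash\Diamond\circ\varphi\to\Box\Diamond\circ\varphi$ (for every formula $\varphi$).
   Context: A frame is Euclidean when $wRu$ and $wRu'$ imply $uRu'$ for all $w,u,u'$. Formulas (language $\mathcal{L}^{\Box,\circ}$) are built from a denumerable set $\mathrm{Var}$ of variables with unary $\neg,\Box,\circ$ and binary $\wedge,\vee$; $\alpha\to\beta:=\neg\alpha\vee\beta$, $\Diamond\alpha:=\neg\Box\neg\alpha$. (8-4)-semantics: let $B_8$ be the eight-element Boolean algebra (top $1$, bottom $0$, join $+$, meet $\cdot$, complement $-$), with $\circledcirc x=1$ if $x\in\{0,1\}$ and $\circledcirc x=0$ otherwise, and $U$ any fixed ultrafilter of $B_8$. Let $B_1,B_2,B_3$ be the three four-element Boolean subalgebras of $B_8$. An (8-4)-frame is $F=\langle W,R,I\rangle$ with $W\neq\emptyset$, $R\subseteq W\times W$, $I:W\to\{B_1,B_2,B_3\}$; write $L_w=I(w)$. A model $M$ based on $F$ adds a function $v$ with $v_w(p)=v(w,p)\in L_w$ for $w\in W$, $p\in\mathrm{Var}$. For $x\in B_8$ and $L'\in\{B_1,B_2,B_3\}$, $x^{L'}=\bigvee_{L'}\{y\in L'\mid y\leq x\}$. Each $v_w$ extends to formulas by $v_w(\neg\alpha)=-v_w(\alpha)$, $v_w(\alpha\vee\beta)=v_w(\alpha)+v_w(\beta)$, $v_w(\alpha\wedge\beta)=v_w(\alpha)\cdot v_w(\beta)$, $v_w(\circ\alpha)=\circledcirc(v_w(\alpha))$,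 $v_w(\Box\alpha)=\bigwedge_{L_w}\{(v_u(\alpha))^{L_w}\mid u\in W,\ wRu\}$. $M,w\vDash\varphi$ iff $v_w(\varphi)\in U\cap L_w$; $M\vDash\varphi$ iff $M,w\vDash\varphi$ for all $w\in W$; $F\vDash\varphi$ iff $M\vDash\varphi$ for every model $M$ based on $F$. *)

(* Defs.v *)
From mathcomp Require Import all_boot.
From mathcomp Require Import boolp.

Set Implicit Arguments.
Unset Strict Implicit.
Unset Printing Implicit Defensive.

Inductive formula : Type :=
  | Var of nat
  | Neg of formula
  | Box of formula
  | Circ of formula
  | And of formula & formula
  | Or of formula & formula.

Definition Imp (a b : formula) : formula := Or (Neg a) b.
Definition Dia (a : formula) : formula := Neg (Box (Neg a)).

(* The eight-element Boolean algebra, as the power set of its three atoms: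
   0, 1, +, ., - and <= are set0, setT, :|:, :&:, ~: and \subset. *)
Definition B8 := {set 'I_3}.

Definition consistency (x : B8) : B8 :=
  if x \in [set set0; setT] then setT else set0.

Definition proper_filter (U : {set B8}) : bool :=
  [&& setT \in U, set0 \notin U,
      [forall x in U, forall y in U, x :&: y \in U]
    & [forall x in U, forall y : B8, (x \subset y) ==> (y \in U)]].

Definition ultrafilter (U : {set B8}) : bool := maxset proper_filter U.

Definition subalgebra (L : {set B8}) : bool :=
  [&& set0 \in L, setT \in L,
      [forall x in L, ~: x \in L],
      [forall x in L, forall y in L, x :|: y \in L]
    & [forall x in L, forall y in L, x :&: y \in L]].

Definition subalgebra4 (L : {set B8}) : bool := subalgebra L && (#|L| == 4).

(* Joins and meets in a subalgebra L of subsets of L are those of B8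
   (lemmas bigcup_subalgebra and bigcap_subalgebra). *)
Definition approx (L : {set B8}) (x : B8) : B8 :=
  \bigcup_(y in L | y \subset x) y.

Record frame : Type := Frame {
  world : Type;
  world_nonempty : inhabited world;
  acc : world -> world -> Prop;
  alg : world -> {set B8};
  algP : forall w, subalgebra4 (alg w)
}.

Definition euclidean (F : frame) : Prop :=
  forall w u u' : world F, acc w u -> acc w u' -> acc u u'.

Record model (F : frame) : Type := Model {
  val_var : world F -> nat -> B8;
  val_varP : forall w p, val_var w p \in alg w
}.

Fixpoint eval (F : frame) (M : model F) (a : formula) (w : world F) : B8 :=
  match a with
  | Var p => val_var M w p
  | Neg b => ~: eval M b w
  | Box b => \bigcap_(y : B8 |
      `[< exists2 u, acc w u & y = approx (alg w) (eval M b u) >]) y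
  | Circ b => consistency (eval M b w)
  | And b c => eval M b w :&: eval M c w
  | Or b c => eval M b w :|: eval M c w
  end.

Definition holds (U : {set B8}) (F : frame) (M : model F) (w : world F)
    (a : formula) : Prop :=
  eval M a w \in U :&: alg w.

Definition model_valid (U : {set B8}) (F : frame) (M : model F)
    (a : formula) : Prop :=
  forall w : world F, holds U M w a.

Definition frame_valid (U : {set B8}) (F : frame) (a : formula) : Prop :=
  forall M : model F, model_valid U M a.

Lemma card_B8 : #|{: B8}| = 8.
Proof. by rewrite -cardsT -powersetT card_powerset cardsT card_ord. Qed.

Lemma subalgebraP (L : {set B8}) :
  reflect [/\ set0 \in L, setT \in L,
              forall x, x \in L -> ~: x \in L,
              forall x y, x \in L -> y \in L -> x :|: y \in L
            & forall x y, x \in L -> y \in L -> x :&: y \in L]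
          (subalgebra L).
Proof.
apply: (iffP and5P) => -[h0 hT hC hU hI]; split=> //.
- by move=> x xL; move/forall_inP: hC; apply.
- by move=> x y xL yL; move/forall_inP/(_ x xL)/forall_inP: hU; apply.
- by move=> x y xL yL; move/forall_inP/(_ x xL)/forall_inP: hI; apply.
- by apply/forall_inP.
- by apply/forall_inP => x xL; apply/forall_inP => y; apply: hU.
- by apply/forall_inP => x xL; apply/forall_inP => y; apply: hI.
Qed.

Lemma bigcup_subalgebra (L : {set B8}) (P : pred B8) :
  subalgebra L -> (forall y, P y -> y \in L) -> \bigcup_(y | P y) y \in L.
Proof.
by case/subalgebraP=> h0 _ _ hU _ PL; apply: (big_ind (fun x => x \in L)).
Qed.

Lemma bigcap_subalgebra (L : {set B8}) (P : pred B8) :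
  subalgebra L -> (forall y, P y -> y \in L) -> \bigcap_(y | P y) y \in L.
Proof.
by case/subalgebraP=> _ hT _ _ hI PL; apply: (big_ind (fun x => x \in L)).
Qed.

Lemma approx_in (L : {set B8}) (x : B8) : subalgebra L -> approx L x \in L.
Proof. by move=> hL; apply: bigcup_subalgebra => // y /andP[]. Qed.

Lemma eval_in (F : frame) (M : model F) (a : formula) (w : world F) :
  eval M a w \in alg w.
Proof.
have /andP[sL _] := algP w; case/subalgebraP: (sL) => h0 hT hC hU hI.
elim: a => [p|b IHb|b _|b IHb|b IHb c IHc|b IHb c IHc] /=.
- exact: val_varP.
- exact: hC.
- by apply: bigcap_subalgebra => // y /asboolP[u _ ->]; apply: approx_in.
- by rewrite /consistency; case: ifP.
- exact: hI.
- exact: hU.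
Qed.

Definition generated4 (i : 'I_3) : {set B8} :=
  [set set0; setT; [set i]; ~: [set i]].

Lemma subalgebra4P (L : {set B8}) :
  reflect (exists i, L = generated4 i) (subalgebra4 L).
Proof.
have cardg i : #|generated4 i| = 4.
  have c1 : #|[set i]| = 1 by rewrite cards1.
  have c2 : #|~: [set i]| = 2 by rewrite cardsCs setCK card_ord cards1.
  have c3 : #|[set: 'I_3]| = 3 by rewrite cardsT card_ord.
  have c0 : #|set0 : {set 'I_3}| = 0 by rewrite cards0.
  have ne (x y : B8) : #|x| != #|y| -> (x == y) = false.
    by move=> h; apply/eqP => e; rewrite e eqxx in h.
  rewrite /generated4 -[_ :|: [set ~: _]]setUC cardsU1 -[_ :|: [set [set i]]]setUC.
  rewrite cardsU1 cards2 !inE.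
  by rewrite !ne // ?c0 ?c1 ?c2 ?c3.
apply: (iffP andP) => [[sL /eqP cL]|[i ->]]; last first.
  split; last by rewrite cardg.
  apply/subalgebraP; split; rewrite ?inE ?eqxx ?orbT //.
  - by move=> x; rewrite !inE => /orP[/orP[/orP[]|]|] /eqP->;
      rewrite ?setC0 ?setCT ?setCK ?eqxx ?orbT.
  - by move=> x y; rewrite !inE => /orP[/orP[/orP[]|]|] /eqP->
      /orP[/orP[/orP[]|]|] /eqP->;
      rewrite ?set0U ?setU0 ?setTU ?setUT ?setUid ?setUCr ?[~: _ :|: [set i]]setUC ?setUCr ?eqxx ?orbT.
  - by move=> x y; rewrite !inE => /orP[/orP[/orP[]|]|] /eqP->
      /orP[/orP[/orP[]|]|] /eqP->;
      rewrite ?set0I ?setI0 ?setTI ?setIT ?setIid ?setICr ?[~: _ :&: [set i]]setIC ?setICr ?eqxx ?orbT.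
case/subalgebraP: sL => h0 hT hC _ _.
suff [i iL] : exists i, [set i] \in L.
  exists i; apply/eqP; rewrite eq_sym eqEcard cardg cL leqnn andbT.
  apply/subsetP => x; rewrite !inE.
  by move=> /orP[/orP[/orP[]|]|] /eqP-> //; apply: hC.
have /subsetPn[x xL] : ~~ (L \subset [set set0; setT]).
  apply/negP => /subset_leq_card; rewrite cL cards2.
  by case: (_ != _).
rewrite !inE negb_or => /andP[x0 xT].
have := max_card (mem x); rewrite card_ord.
have : #|x| != 0 by rewrite cards_eq0.
have : #|x| != 3.
  apply: contra xT => /eqP c; by rewrite eqEcard subsetT cardsT card_ord c.
case E: #|x| => [|[|[|[|//]]]] // _ _ _.
  by have /cards1P[i e] : #|x| == 1 by [rewrite E]; exists i; rewrite -e.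
have /cards1P[i e] : #|~: x| == 1 by rewrite cardsCs setCK card_ord E.
by exists i; rewrite -e; apply: hC.
Qed.

(* Main.v *)
Require Import Defs.
From mathcomp Require Import all_boot.
From mathcomp Require Import boolp.

Set Implicit Arguments.
Unset Strict Implicit.
Unset Printing Implicit Defensive.

(** The formula Circ phi takes only the values 0 and 1, and on two-valued
    formulas this semantics is ordinary Kripke semantics: 0 and 1 belong to
    every subalgebra, so the approximation of a value in the algebra of
    another world leaves them unchanged ([eval_Box_truth]).  Hence
    Dia (Circ phi) -> Box (Dia (Circ phi)) says at w that, if some successor
    of w satisfies P, then every successor of w has a successor satisfying P,
    where P u means that Circ phi is 1 at u ([eval_axiom5]).  On a Euclidean
    frame this holds for every P.

    For the converse it suffices that P can be an arbitrary predicate, in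
    particular the singleton of a world.  It can already for phi a variable:
    a four-element subalgebra contains an element other than 0 and 1, so at
    each world the variable can be given a value on which the consistency
    operator is 0 as well as one on which it is 1 ([Circ_var_any]). *)

Definition truth (P : Prop) : B8 := if `[< P >] then setT else set0.

Lemma truthN (P : Prop) : ~: truth P = truth (~ P).
Proof. by rewrite /truth asbool_neg; case: asboolP; rewrite ?setCT ?setC0. Qed.

Lemma truthU (P Q : Prop) : truth P :|: truth Q = truth (P \/ Q).
Proof.
by rewrite /truth asbool_or; case: asboolP; case: asboolP;
  rewrite ?setTU ?set0U.
Qed.

Lemma consistency_truth (x : B8) :
  consistency x = truth (x \in [set set0; setT]).
Proof. by rewrite /truth asboolb. Qed.

Lemma ultrafilter_truth (U : {set B8}) (P : Prop) :
  ultrafilter U -> truth P \in U <-> P.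
Proof.
move=> /maxsetP[/and4P[UT U0 _ _] _].
by rewrite /truth; case: asboolP => // nP; split=> // /(negP U0).
Qed.

Lemma approx_mem (L : {set B8}) (x : B8) : x \in L -> approx L x = x.
Proof.
move=> xL; apply/eqP; rewrite eqEsubset; apply/andP; split.
  by apply/bigcupsP => y /andP[].
by apply: bigcup_sup; rewrite xL subxx.
Qed.

Lemma approx_truth (L : {set B8}) (P : Prop) :
  subalgebra4 L -> approx L (truth P) = truth P.
Proof.
move=> /andP[/subalgebraP[L0 LT _ _ _] _].
by apply: approx_mem; rewrite /truth; case: ifP.
Qed.

(** A meet of values 0 and 1, each unchanged by approximation, is 1 exactly
    when all of them are. *)
Lemma eval_Box_truth (F : frame) (M : model F) (a : formula)
    (P : world F -> Prop) (w : world F) :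
  (forall u, eval M a u = truth (P u)) ->
  eval M (Box a) w = truth (forall u, acc w u -> P u).
Proof.
move=> aE /=; have approxE u : approx (alg w) (eval M a u) = truth (P u).
  by rewrite aE approx_truth // algP.
rewrite {1}/truth; case: asboolP => [allP | /existsNP[u /not_implyP[wu nPu]]].
  apply: big1 => y /asboolP[u wu ->].
  by rewrite approxE /truth asboolT //; apply: allP.
apply/eqP; rewrite -subset0; apply: bigcap_inf.
apply/asboolP; exists u => //.
by rewrite approxE /truth asboolF.
Qed.

Lemma eval_Dia_truth (F : frame) (M : model F) (a : formula)
    (P : world F -> Prop) (w : world F) :
  (forall u, eval M a u = truth (P u)) ->
  eval M (Dia a) w = truth (exists2 u, acc w u & P u).
Proof.
move=> aE; have naE u : eval M (Neg a) u = truth (~ P u) by rewrite /= aE truthN.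
rewrite -[LHS]/(~: eval M (Box (Neg a)) w) (eval_Box_truth _ naE) truthN.
congr truth; rewrite propeqE; split=> [/existsNP[u /not_implyP[wu /contrapT]]|].
  by exists u.
by case=> u wu Pu /(_ u wu).
Qed.

Lemma eval_axiom5 (F : frame) (M : model F) (a : formula)
    (P : world F -> Prop) (w : world F) :
  (forall u, eval M a u = truth (P u)) ->
  eval M (Imp (Dia a) (Box (Dia a))) w =
    truth ((exists2 u, acc w u & P u) ->
           forall u, acc w u -> exists2 u', acc u u' & P u').
Proof.
move=> aE; have daE u := eval_Dia_truth u aE.
rewrite -[LHS]/(~: eval M (Dia a) w :|: eval M (Box (Dia a)) w).
by rewrite daE (eval_Box_truth _ daE) truthN truthU -implyE.
Qed.

Lemma subalgebra4_nontrivial (L : {set B8}) :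
  subalgebra4 L -> exists2 x, x \in L & x \notin [set set0; setT].
Proof.
move=> /andP[_ /eqP cL]; apply/subsetPn/negP => /subset_leq_card.
by rewrite cL cards2; case: (_ != _).
Qed.

(** This is where the local algebras must be larger than {0, 1}: in two-valued
    worlds Circ (Var p) would be 1 everywhere, and the axiom would only say that
    every successor has a successor. *)
Lemma Circ_var_any (F : frame) (P : world F -> Prop) :
  exists M : model F, forall p w, eval M (Circ (Var p)) w = truth (P w).
Proof.
have valP w : exists x, x \in alg w /\ (x \in [set set0; setT] <-> P w).
  have [Pw | nPw] := EM (P w).
    exists set0; rewrite !inE eqxx; split=> //.
    by have /andP[/subalgebraP[]] := algP w.
  by have [x xL /negP xN] := subalgebra4_nontrivial (algP w); exists x; split.
have [v vP] := choice valP.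
exists (@Model F (fun w _ => v w) (fun w _ => proj1 (vP w))) => p w /=.
by rewrite consistency_truth; congr truth; rewrite propeqE; apply: (vP w).2.
Qed.

Theorem theorem5p5 (U : {set B8}) (hU : ultrafilter U) (F : frame) :
  euclidean F <->
  (forall phi : formula,
     frame_valid U F (Imp (Dia (Circ phi)) (Box (Dia (Circ phi))))).
Proof.
split=> [euc phi M w | valid w u u' wu wu'].
  have circE u : eval M (Circ phi) u = truth (eval M phi u \in [set set0; setT]).
    exact: consistency_truth.
  rewrite /holds in_setI eval_in andbT (eval_axiom5 w circE).
  apply/ultrafilter_truth => // -[u wu Pu] u' wu'.
  by exists u => //; apply: euc wu' wu.
(* With the singleton of u' as predicate, the axiom at w gives u a successor
   equal to u'. *)
have [M ME] := Circ_var_any (fun x : world F => x = u').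
have := valid (Var 0) M w.
rewrite /holds in_setI eval_in andbT (eval_axiom5 w (ME 0)).
move=> /(ultrafilter_truth _ hU) ax.
by have [|v uv <-] := ax _ u wu; first by exists u'.
Qed.
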